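(* Suppose the following statement (A) holds: for every $m\ge 1$ and all non-overlapping permutations $\pi,\tau\in\mathfrak{S}_m$ that are in standard form, if $\pi$ and $\tau$ are c-Wilf equivalent then $\pi_1=\tau_1$ and $\pi_m=\tau_m$. Then the following statement (B) holds: for every $m\ge 1$ and all permutations $\pi,\tau\in\mathfrak{S}_m$ in standard form, if $\pi$ and $\tau$ are strongly c-Wilf equivalent then $\pi_1=\tau_1$ and $\pi_m=\tau_m$.
   Context: $\mathfrak{S}_n$ is the symmetric group on $[n]$, permutations written $\sigma=\sigma_1\cdots\sigma_n$, and $\mathfrak{S}=\bigcup_{n\ge0}\mathfrak{S}_n$. The standardization $\operatorname{st}(w)$ of a word of distinct integers replaces its smallest entry by 1, the next smallest by 2, etc. For $\pi\in\mathfrak{S}_m$ and $\sigma\in\mathfrak{S}_n$, $\operatorname{Em}(\pi,\sigma)=\{i\in[n-m+1]:\operatorname{st}(\sigma_i\cdots\sigma_{i+m-1})=\pi\}$ and $\operatorname{em}(\pi,\sigma)=|\operatorname{Em}(\pi,\sigma)|$. Let $a^\pi_{n,k}$ be the number of $\sigma\in\mathfrak{S}_n$ with $\operatorname{em}(\pi,\sigma)=k$. Two permutations $\pi,\tau$ are c-Wilf equivalent if $a^\pi_{n,0}=a^\tau_{n,0}$ for all $n$, and strongly c-Wilf equivalent if $a^\pi_{n,k}=a^\tau_{n,k}$ for all $n,k$. The overlap set of $\pi\in\mathfrak{S}_m$ is $\mathcal{O}_\pi=\{i\in[m-1]:\operatorname{st}(\pi_{i+1}\cdots\pi_m)=\operatorname{st}(\pi_1\cdots\pi_{m-i})\}$;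 $\pi$ is non-overlapping if $\mathcal{O}_\pi=\{m-1\}$. A permutation $\pi\in\mathfrak{S}_m$ is in standard form if $\pi_1<\pi_m$ and $\pi_1+\pi_m\le m+1$. *)

(* Defs.v *)
From mathcomp Require Import all_boot all_order all_fingroup.
Set Implicit Arguments. Unset Strict Implicit. Unset Printing Implicit Defensive.

(* The one-line notation sigma_1 ... sigma_n of sigma in S_n, with values in
   {1,...,n} (the perm acts on 'I_n = {0,...,n-1}, so we add 1). *)
Definition pword n (s : 'S_n) : seq nat := [seq (s i).+1 | i <- enum 'I_n].

Definition st (w : seq nat) : seq nat := [seq (count (fun y => y < x) w).+1 | x <- w].

(* Em(p, w) with 0-based starting positions: i in {0,...,n-m} such that
   st(w_i ... w_{i+m-1}) = p, where m = size p, n = size w. *)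
Definition Em (p w : seq nat) : seq nat :=
  [seq i <- iota 0 ((size w).+1 - size p) | st (take (size p) (drop i w)) == p].

Definition em (p w : seq nat) : nat := size (Em p w).

Definition acount m (pi : 'S_m) (n k : nat) : nat :=
  #|[set s : 'S_n | em (pword pi) (pword s) == k]|.

Definition cwilf_equiv m (pi tau : 'S_m) : Prop :=
  forall n, acount pi n 0 = acount tau n 0.

Definition strong_cwilf_equiv m (pi tau : 'S_m) : Prop :=
  forall n k, acount pi n k = acount tau n k.

Definition overlap_set m (pi : 'S_m) : seq nat :=
  [seq i <- iota 1 m.-1 | st (drop i (pword pi)) == st (take (m - i) (pword pi))].

Definition non_overlapping m (pi : 'S_m) : Prop := overlap_set pi = [:: m.-1].

Definition pfirst m (pi : 'S_m) : nat := nth 0 (pword pi) 0.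
Definition plast m (pi : 'S_m) : nat := nth 0 (pword pi) m.-1.

Definition standard_form m (pi : 'S_m) : Prop :=
  pfirst pi < plast pi /\ pfirst pi + plast pi <= m.+1.

(* Main.v *)
Require Import Defs.
From mathcomp Require Import all_boot all_order all_fingroup all_algebra zify ring.
Set Implicit Arguments. Unset Strict Implicit. Unset Printing Implicit Defensive.
Import GRing.Theory.
Implicit Types p u v w : seq nat.

(** The generating function of the occurrence statistic and the generating
    function of clusters (marked occurrences covering a word, consecutive ones
    sharing a letter) determine each other, as in the Goulden-Jackson method.
    The clusters with k occurrences and maximal length k(m-1)+1 overlap in one
    letter only, so strong equivalence preserves their numbers M_k, and
    permuting the inner positions of each block shows that M_k depends only on
    the pair (pi_1, pi_m). A non-overlapping permutation has no other clusters,
    so its numbers of avoiders are determined by the M_k. Hence the result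
    follows from (A) once pi and tau are replaced by non-overlapping
    permutations with the same ends. Such permutations exist unless the ends
    are (1, m), or (2, 3) with m = 4; these cases are told apart by M_2. *)

(** * Words and standardization *)

Definition words n : seq (seq nat) := permutations (iota 1 n).

(** Equality of standardizations, by [st_eqP], in a form that restricts at once to prefixes and
    suffixes. *)
Definition order_iso (u v : seq nat) : Prop :=
  size u = size v /\ forall i j, i < size u -> j < size u ->
    (nth 0 u i < nth 0 u j) = (nth 0 v i < nth 0 v j).

Lemma size_words n w : w \in words n -> size w = n.
Proof. by rewrite mem_permutations => /perm_size; rewrite size_iota. Qed.

Lemma uniq_words n w : w \in words n -> uniq w.
Proof. by rewrite mem_permutations => /perm_uniq ->; rewrite iota_uniq. Qed.

Lemma mem_words n w x : w \in words n -> (x \in w) = (0 < x <= n).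
Proof. by rewrite mem_permutations => /perm_mem ->; rewrite mem_iota add1n ltnS. Qed.

Lemma nth_words n w i : w \in words n -> i < n -> 0 < nth 0 w i <= n.
Proof. by move=> wn lt_in; rewrite -(mem_words _ wn) mem_nth ?(size_words wn). Qed.

Lemma in_words n w :
  uniq w -> size w = n -> (forall x, x \in w -> 0 < x <= n) -> w \in words n.
Proof.
move=> uw sw win; rewrite mem_permutations.
have sub : {subset w <= iota 1 n} by move=> x /win; rewrite mem_iota; lia.
have [|_ eqw] := uniq_min_size uw sub; first by rewrite size_iota sw.
by rewrite uniq_perm ?iota_uniq.
Qed.

Lemma mkseq_words n f :
  (forall i, i < n -> 0 < f i <= n) ->
  (forall i j, i < n -> j < n -> f i = f j -> i = j) -> mkseq f n \in words n.
Proof.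
move=> fn finj; apply: in_words; rewrite ?size_mkseq //.
  rewrite map_inj_in_uniq ?iota_uniq // => i j; rewrite !mem_iota !add0n /=.
  exact: finj.
by move=> x /mapP[i]; rewrite mem_iota add0n /= => /fn ? ->.
Qed.

(** If [x < y], the entry [x] itself is counted on the right and not on the left. *)
Lemma count_ltn_mono w x y : x \in w ->
  (count (fun z => z < x) w < count (fun z => z < y) w) = (x < y).
Proof.
move=> xw; case: (ltnP x y) => [lt_xy|le_yx]; last first.
  by apply/negbTE; rewrite -leqNgt sub_count // => z /= /leq_trans; apply.
have -> : count (fun z => z < y) w =
    count (fun z => z < x) w + count (fun z => x <= z < y) w.
  elim: w {xw} => //= z w ->; have : (z < y) = (z < x) + (x <= z < y) :> nat by lia.
  lia.
suff : 0 < count (fun z => x <= z < y) w by lia.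
by rewrite -has_count; apply/hasP; exists x => //=; lia.
Qed.

Lemma size_st w : size (st w) = size w.
Proof. exact: size_map. Qed.

Lemma nth_st w i : i < size w ->
  nth 0 (st w) i = (count (fun y => y < nth 0 w i) w).+1.
Proof. by move=> lt_iw; rewrite (nth_map 0). Qed.

Lemma order_iso_st w : order_iso (st w) w.
Proof.
split=> [|i j]; rewrite size_st // => ? ?.
by rewrite !nth_st // ltnS count_ltn_mono ?mem_nth.
Qed.

Lemma order_iso_sym u v : order_iso u v -> order_iso v u.
Proof. by case=> suv uv; split=> // i j; rewrite -suv => ? ?; rewrite uv. Qed.

Lemma order_iso_trans v u w : order_iso u v -> order_iso v w -> order_iso u w.
Proof.
by case=> suv uv [svw vw]; split=> [|i j ? ?]; rewrite ?suv // uv // vw -?suv.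
Qed.

Lemma order_iso_take k u v : order_iso u v -> order_iso (take k u) (take k v).
Proof.
case=> suv uv; split=> [|i j]; first by rewrite !size_take suv.
rewrite size_take_min !leq_min => /andP[? ?] /andP[? ?].
by rewrite !nth_take // uv.
Qed.

Lemma order_iso_drop k u v : order_iso u v -> order_iso (drop k u) (drop k v).
Proof.
case=> suv uv; split=> [|i j]; rewrite !size_drop ?suv // => ? ?.
by rewrite !nth_drop uv // ?suv; lia.
Qed.

Lemma st_eqP u v : st u = st v <-> order_iso u v.
Proof.
split=> [eq_st|iso].
  apply: order_iso_trans (order_iso_st v); rewrite -eq_st.
  exact/order_iso_sym/order_iso_st.
have [suv uv] := iso.
apply: (@eq_from_nth _ 0) => [|i]; rewrite !size_st // => lt_iu.
rewrite !nth_st -?suv //; congr _.+1.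
have cnt w x : count (fun y => y < x) w =
    count (fun j => nth 0 w j < x) (iota 0 (size w)).
  by rewrite -{1}(mkseq_nth 0 w) count_map.
rewrite (cnt u) (cnt v) -suv; apply: eq_in_count => j.
by rewrite mem_iota => /andP[_ lt_ju]; rewrite uv.
Qed.

Lemma count_ltn_iota n x : 0 < x <= n.+1 -> count (fun y => y < x) (iota 1 n) = x.-1.
Proof.
elim: n => [|n IHn] x_n; first by case: x x_n => [|[]].
rewrite -(addn1 n) iotaD count_cat /=.
case: (ltnP n.+1 x) => [lt_nx|le_xn]; last by rewrite IHn; lia.
have -> : x = n.+2 by lia.
rewrite (@eq_in_count _ _ xpredT); first by rewrite count_predT size_iota; lia.
by move=> y; rewrite mem_iota; lia.
Qed.

Lemma st_words n w : w \in words n -> st w = w.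
Proof.
move=> wn; rewrite -[RHS]map_id; apply/eq_in_map => x xw.
move: wn (xw); rewrite mem_permutations => wn.
rewrite (perm_mem wn) mem_iota (seq.permP wn) => x_n.
by rewrite count_ltn_iota; lia.
Qed.

Lemma st_in_words w : uniq w -> st w \in words (size w).
Proof.
move=> uw; apply: in_words; rewrite ?size_st //.
  rewrite map_inj_in_uniq // => x y xw yw [] eqc.
  have := count_ltn_mono y xw; have := count_ltn_mono x yw.
  by rewrite eqc ltnn; lia.
move=> _ /mapP[x xw ->] /=; have := count_predC (fun y => y < x) w.
have : 0 < count (predC (fun y => y < x)) w.
  by rewrite -has_count; apply/hasP; exists x => //=; rewrite ltnn.
lia.
Qed.

Lemma st_inj_perm u v : perm_eq u v -> st u = st v -> u = v.
Proof.
move=> puv eq_st; have [suv _] := (st_eqP u v).1 eq_st.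
apply: (@eq_from_nth _ 0) => // i lt_iu.
have := congr1 (fun w => nth 0 w i) eq_st.
rewrite !nth_st -?suv // -(seq.permP puv) => -[eqc].
have iu : nth 0 u i \in u by rewrite mem_nth.
have iv : nth 0 v i \in u by rewrite (perm_mem puv) mem_nth -?suv.
have := count_ltn_mono (nth 0 u i) iv; have := count_ltn_mono (nth 0 v i) iu.
by rewrite eqc ltnn; lia.
Qed.

Lemma pword_words n (s : 'S_n) : pword s \in words n.
Proof.
apply: in_words; rewrite /pword; last 2 first.
- by rewrite size_map size_enum_ord.
- by move=> x /mapP[i _ ->]; have := ltn_ord (s i); lia.
by rewrite map_inj_uniq ?enum_uniq // => i j [] /val_inj /perm_inj.
Qed.

Lemma pword_inj n : injective (@pword n).
Proof.
move=> s t /eq_in_map eq_st; apply/permP => i.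
by have [] := eq_st i (mem_enum _ _); move/val_inj.
Qed.

Lemma perm_eq_words n : perm_eq [seq pword s | s <- enum 'S_n] (words n).
Proof.
have us : uniq [seq pword s | s <- enum 'S_n].
  by rewrite map_inj_uniq ?enum_uniq //; apply: pword_inj.
have sub : {subset [seq pword s | s <- enum 'S_n] <= words n}.
  by move=> w /mapP[s _ ->]; apply: pword_words.
have [|_ eqw] := uniq_min_size us sub.
  rewrite size_permutations ?iota_uniq // size_iota size_map -cardE.
  by rewrite card_Sn.
by rewrite uniq_perm ?permutations_uniq.
Qed.

Lemma wordsP n w : w \in words n -> exists s : 'S_n, pword s = w.
Proof. by rewrite -(perm_mem (perm_eq_words n)) => /mapP[s _ ->]; exists s. Qed.

Lemma acount_words m (pi : 'S_m) n k :
  acount pi n k = count (fun w => em (pword pi) w == k) (words n).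
Proof.
rewrite /acount -(seq.permP (perm_eq_words n)) count_map -sum1_count -sum1_card.
by rewrite big_enum_cond; apply: eq_bigl => s; rewrite inE.
Qed.

Lemma size_words_list n : size (words n) = n`!.
Proof. by rewrite size_permutations ?iota_uniq // size_iota. Qed.

Definition value_set n (u : seq nat) : {set 'I_n} := [set i : 'I_n | i.+1 \in u].

Lemma card_value_set n u : uniq u -> (forall x, x \in u -> 0 < x <= n) ->
  #|value_set n u| = size u.
Proof.
move=> uu un; rewrite cardE -(size_map (fun i : 'I_n => i.+1)).
apply/perm_size/uniq_perm => //; first by rewrite map_inj_uniq ?enum_uniq // => i j [] /val_inj.
move=> x; apply/mapP/idP => [[i]|xu]; first by rewrite mem_enum inE => ? ->.
have := un x xu; case: x xu => // x xu lt_xn.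
by exists (Ordinal lt_xn); rewrite ?mem_enum ?inE.
Qed.

(* A word of [words n] is determined by the set of its first [l] values and
   the standardizations of its two factors; injectivity plus the cardinality
   identity [n! = 'C(n, l) * l! * (n - l)!] gives a bijection. *)
Lemma perm_split_words n l : l <= n ->
  perm_eq [seq (value_set n (take l w), (st (take l w), st (drop l w))) | w <- words n]
    [seq (A, uv) | A <- enum [set A : {set 'I_n} | #|A| == l],
                   uv <- [seq (u, v) | u <- words l, v <- words (n - l)]].
Proof.
move=> le_ln; set s1 := (X in perm_eq X _); set s2 := (X in perm_eq _ X).
have us1 : uniq s1.
  rewrite map_inj_in_uniq ?permutations_uniq // => w w' wn wn' [eqA eqt eqd].
  have uw := uniq_words wn; have uw' := uniq_words wn'.
  have ptake : perm_eq (take l w) (take l w').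
    apply: uniq_perm; rewrite ?take_uniq // => x.
    have out z : z \in words n -> x \in take l z -> 0 < x <= n.
      by move=> zn /mem_take; rewrite (mem_words _ zn).
    case: (boolP (0 < x <= n)) => [x_n|x_n]; last first.
      by apply/idP/idP => [/(out _ wn)|/(out _ wn')]; rewrite (negbTE x_n).
    case: x x_n {out} => // x lt_xn.
    have := congr1 (fun A : {set 'I_n} => Ordinal (lt_xn : x < n) \in A) eqA.
    by rewrite !inE.
  have pw : perm_eq w w'.
    move: wn wn'; rewrite !mem_permutations => pw pw'.
    by rewrite (perm_trans pw) // perm_sym.
  have pdrop : perm_eq (drop l w) (drop l w').
    rewrite -(perm_cat2l (take l w)) cat_take_drop (perm_trans pw) //.
    by rewrite -{1}(cat_take_drop l w') perm_cat2r perm_sym.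
  rewrite -[LHS](cat_take_drop l) (st_inj_perm ptake eqt) (st_inj_perm pdrop eqd).
  by rewrite cat_take_drop.
have us2 : uniq s2.
  apply: allpairs_uniq; rewrite ?enum_uniq //; last by move=> [? ?] [? ?].
  by apply: allpairs_uniq; rewrite ?permutations_uniq // => -[? ?] [? ?].
have sub : {subset s1 <= s2}.
  move=> _ /mapP[w wn ->]; apply: allpairs_f.
    rewrite mem_enum inE card_value_set ?take_uniq ?(uniq_words wn) //.
      by rewrite size_takel ?(size_words wn).
    by move=> x /mem_take; rewrite (mem_words _ wn).
  apply: allpairs_f.
    have := st_in_words (take_uniq l (uniq_words wn)).
    by rewrite size_takel ?(size_words wn).
  have := st_in_words (drop_uniq l (uniq_words wn)).
  by rewrite size_drop ?(size_words wn).
have [|_ eqs] := uniq_min_size us1 sub; last by rewrite uniq_perm.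
rewrite !size_allpairs size_map !size_words_list -cardE card_draws card_ord.
by rewrite bin_fact.
Qed.

Local Open Scope ring_scope.

(** The value set of the prefix, its pattern and the pattern of the suffix are independent data; the
    first can be chosen in ['C(n, l)] ways. *)
Lemma sum_words_split (R : comPzRingType) n l (f g : seq nat -> R) : (l <= n)%N ->
  \sum_(w <- words n) f (st (take l w)) * g (st (drop l w)) =
  'C(n, l)%:R * ((\sum_(u <- words l) f u) * (\sum_(v <- words (n - l)) g v)).
Proof.
move=> le_ln.
transitivity (\sum_(x <- [seq (value_set n (take l w), (st (take l w), st (drop l w)))
                            | w <- words n])
  f x.2.1 * g x.2.2); first by rewrite big_map.
rewrite (perm_big _ (perm_split_words le_ln)) /= big_allpairs /=.
under eq_bigr do rewrite big_allpairs /=.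
rewrite big_const_seq count_predT -cardE card_draws card_ord iter_addr_0 mulr_natl.
congr (_ *+ _); rewrite big_distrl /=; apply: eq_bigr => u _.
by rewrite big_distrr.
Qed.

(** * Clusters *)

Definition occ (p w : seq nat) : bool := st (take (size p) w) == p.

Lemma occ_size p w : occ p w -> (size p <= size w)%N.
Proof. by move/eqP/(congr1 size); rewrite size_st size_take_min => <-; rewrite geq_minr. Qed.

Lemma occ_nil p : p != [::] -> occ p [::] = false.
Proof. by case: p. Qed.

Lemma occ_take p l w : (size p <= l)%N -> occ p (take l w) = occ p w.
Proof. by move=> le_pl; rewrite /occ take_takel. Qed.

Lemma occ_iso p u v : order_iso u v -> occ p u = occ p v.
Proof. by move=> uv; rewrite /occ ((st_eqP _ _).2 (order_iso_take _ uv)). Qed.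

Lemma em_cons p x w : p != [::] -> em p (x :: w) = (occ p (x :: w) + em p w)%N.
Proof.
move=> p0; rewrite /em /Em !size_filter /=.
case: (leqP (size p) (size w).+1) => [le_pw|lt_wp]; last first.
  have -> : ((size w).+2 - size p = 0)%N by lia.
  have -> : ((size w).+1 - size p = 0)%N by lia.
  case: (boolP (occ p _)) => // /occ_size /=; lia.
rewrite (_ : ((size w).+2 - size p = ((size w).+1 - size p).+1)%N); last by lia.
by rewrite /= -[1%N]/(1 + 0)%N iotaDl count_map.
Qed.

Lemma em_nil p : p != [::] -> em p [::] = 0%N.
Proof. by case: p. Qed.

(** Expanding the power sums over all subsets of marked occurrences, with ['X] counting the
    marks. *)
Definition em_weight p w : {poly int} := (1 + 'X) ^+ em p w.

Lemma em_weight_behead p w : p != [::] ->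
  em_weight p w = em_weight p (behead w) + (occ p w)%:R * 'X * em_weight p (behead w).
Proof.
move=> p0; case: w => [|x w] /=.
  by rewrite occ_nil ?mul0r ?addr0.
rewrite /em_weight em_cons //; case: (occ _ _); rewrite ?add0n ?mul0r ?addr0 //.
by rewrite add1n exprS mul1r mulrDl mul1r.
Qed.

Lemma em_iso p u v : p != [::] -> order_iso u v -> em p u = em p v.
Proof.
move=> p0; elim: u v => [|x u IHu] [|y v] iso //=; try by case: iso.
rewrite !em_cons // (occ_iso _ iso); congr (_ + _)%N; apply: IHu.
by have := order_iso_drop 1 iso; rewrite /= !drop0.
Qed.

(* The polynomial enumerating, by number of marked occurrences, the ways of
   marking occurrences of [p] in [w] so that the first one starts at the
   beginning of [w], the last one ends at its end, and consecutive ones share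
   a letter; [d] is the distance between the first two marked occurrences. *)
Fixpoint cluster_rec p k w : {poly int} :=
  if k is k'.+1 then
    (occ p w)%:R * 'X *
      ((size w == size p)%:R + \sum_(1 <= d < size p) cluster_rec p k' (drop d w))
  else 0.

Definition cluster p w := cluster_rec p (size w) w.

(** Each step drops at least one letter, so fuel equal to the length suffices. *)
Lemma cluster_recE p k w : (size w <= k)%N -> p != [::] -> cluster_rec p k w = cluster p w.
Proof.
move=> + p0; rewrite /cluster; elim: k {-2}k (leqnn k) w => [|K IH] [|k] leK w le_wk //=.
- by case: w le_wk.
- by case: w le_wk.
case: w le_wk => [|x w] //= le_wk.
  by rewrite occ_nil ?mul0r.
congr (_ * (_ + _)); apply: eq_big_nat => d /andP[d0 _].
by rewrite (IH k) ?(IH (size w)) ?size_drop //=; lia.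
Qed.

Lemma clusterE p w : p != [::] ->
  cluster p w = (occ p w)%:R * 'X *
    ((size w == size p)%:R + \sum_(1 <= d < size p) cluster p (drop d w)).
Proof.
move=> p0; rewrite -(@cluster_recE p (size w).+1) //=.
congr (_ * (_ + _)); apply: eq_bigr => d _.
by rewrite cluster_recE // size_drop; lia.
Qed.

Lemma cluster_nocc p w : p != [::] -> ~~ occ p w -> cluster p w = 0.
Proof. by move=> p0 /negbTE occF; rewrite clusterE // occF !mul0r. Qed.

Lemma cluster_small p w : p != [::] -> (size w < size p)%N -> cluster p w = 0.
Proof. by move=> p0 lt_wp; rewrite cluster_nocc //; apply/negP => /occ_size; lia. Qed.

Lemma cluster_iso p u v : p != [::] -> order_iso u v -> cluster p u = cluster p v.
Proof.
move=> p0; have [k] := ubnP (size u); elim: k u v => // k IH u v lt_uk iso.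
have suv : size u = size v by case: iso.
rewrite !clusterE // suv (occ_iso _ iso).
case: (boolP (occ p v)) => [occv|]; last by rewrite !mul0r.
congr (_ * (_ + _)); apply: eq_big_nat => d /andP[d0 _].
have := occ_size occv; have : (0 < size p)%N by case: p p0 {IH occv}.
by move=> ? ?; rewrite (IH _ (drop d v)) ?size_drop; [| lia | exact: order_iso_drop].
Qed.

(** The left side weighs the markings in which an occurrence at the start is marked. Each splits
    uniquely into the cluster of linked marks beginning there, of length [l], and an arbitrary
    marking of the rest. *)
Lemma sum_cluster_em_weight p w : p != [::] ->
  (occ p w)%:R * 'X * em_weight p (behead w) =
  \sum_(0 <= l < (size w).+1) cluster p (take l w) * em_weight p (drop l w).
Proof.
move=> p0; have p_gt0 : (0 < size p)%N by case: p p0.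
have [k] := ubnP (size w); elim: k w => // k IH w lt_wk.
case: (boolP (occ p w)) => [occw|noccw]; last first.
  rewrite !mul0r big1_seq // => l _.
  case: (leqP (size p) l) => le_pl; last first.
    by rewrite cluster_small ?mul0r // size_take_min; lia.
  by rewrite cluster_nocc ?mul0r // occ_take.
have le_pw := occ_size occw.
transitivity (\sum_(0 <= l < (size w).+1) 'X * ((l == size p)%:R * em_weight p (drop l w) +
   \sum_(1 <= d < size p) cluster p (take (l - d) (drop d w)) * em_weight p (drop l w))); last first.
  apply: eq_big_nat => l /andP[_ lt_lw].
  case: (leqP (size p) l) => le_pl; last first.
    have -> : (l == size p) = false by lia.
    rewrite cluster_small ?size_take_min; [|by []|by lia].
    rewrite !mul0r add0r big1_seq ?mulr0 // => d _.
    by rewrite cluster_small ?mul0r // size_take_min; lia.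
  rewrite clusterE // occ_take // occw size_takel // mul1r -mulrA mulrDl big_distrl /=.
  congr (_ * (_ + _)); apply: eq_big_nat => d /andP[? ?].
  by rewrite take_drop subnK //; lia.
(* By induction this is the weight of the markings of [drop d w] with a mark at its start: all
   markings minus those without that mark. *)
have inner d : (1 <= d < size p)%N ->
    \sum_(0 <= l < (size w).+1) cluster p (take (l - d) (drop d w)) * em_weight p (drop l w) =
    em_weight p (drop d w) - em_weight p (drop d.+1 w).
  move=> /andP[d1 ltd].
  have -> : em_weight p (drop d w) - em_weight p (drop d.+1 w) =
     (occ p (drop d w))%:R * 'X * em_weight p (behead (drop d w)).
    rewrite [em_weight p (drop d w)]em_weight_behead //.
    rewrite (_ : behead (drop d w) = drop d.+1 w); first by ring.
    by rewrite -[behead _]drop1 drop_drop add1n.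
  rewrite IH; last by rewrite size_drop; lia.
  rewrite (big_cat_nat (n := d)) /=; [|by []|by lia].
  rewrite big1_seq ?add0r => [|l]; last first.
    rewrite mem_index_iota => /andP[_ lt_ld]; rewrite cluster_small ?mul0r //.
    by rewrite size_take_min; lia.
  rewrite -{1}[d]add0n big_addn size_drop subSn; last by lia.
  by apply: eq_bigr => l _; rewrite addnK drop_drop.
rewrite -big_distrr /= mul1r big_split /= exchange_big /= (eq_big_nat _ _ inner).
rewrite (bigD1_seq (size p)) ?iota_uniq ?mem_index_iota //=.
rewrite eqxx mul1r big1 ?addr0 => [|l /negbTE ->]; last by rewrite mul0r.
(* The sign is changed in order to telescope. The sum leaves [em_weight p (drop 1 w) - em_weight p
   (drop (size p) w)], and the clusters with a single mark cancel the subtracted term. *)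
rewrite -(opprK (\sum_(1 <= i < size p) _)) -sumrN.
under [X in - X]eq_bigr do rewrite opprB.
rewrite (telescope_sumr (fun d => em_weight p (drop d w))) // drop1.
by congr (_ * _); ring.
Qed.

Lemma em_weight_cluster p w : p != [::] ->
  em_weight p w = em_weight p (behead w) +
    \sum_(0 <= l < (size w).+1) cluster p (take l w) * em_weight p (drop l w).
Proof. by move=> p0; rewrite -sum_cluster_em_weight // -em_weight_behead. Qed.

Definition em_sum p n : {poly int} := \sum_(w <- words n) em_weight p w.
Definition cluster_sum p n : {poly int} := \sum_(w <- words n) cluster p w.

Lemma words0 : words 0 = [:: [::]].
Proof. by []. Qed.

Lemma em_sum0 p : p != [::] -> em_sum p 0 = 1.
Proof. by move=> p0; rewrite /em_sum words0 big_seq1 /em_weight em_nil. Qed.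

Lemma cluster_sum0 p : p != [::] -> cluster_sum p 0 = 0.
Proof. by move=> p0; rewrite /cluster_sum words0 big_seq1 cluster_small //; case: p p0. Qed.

(** Either the first letter starts no marked occurrence and is removed, its value being one of
    [n.+1], or it starts a cluster of some length [l]. *)
Lemma em_sum_rec p n : p != [::] ->
  em_sum p n.+1 = n.+1%:R * em_sum p n +
    \sum_(0 <= l < n.+2) 'C(n.+1, l)%:R * (cluster_sum p l * em_sum p (n.+1 - l)).
Proof.
move=> p0; rewrite {1}/em_sum.
(* The factor 1 is a function of the first letter, so that [sum_words_split] with [l = 1] applies to
   this term too. *)
transitivity (\sum_(w <- words n.+1) (1 * em_weight p (st (drop 1 w)) +
   \sum_(0 <= l < n.+2) cluster p (st (take l w)) * em_weight p (st (drop l w)))).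
  apply: eq_big_seq => w wn; rewrite em_weight_cluster // (size_words wn) mul1r drop1.
  congr (_ + _); first by rewrite /em_weight (em_iso p0 (order_iso_st _)).
  apply: eq_bigr => l _; rewrite (cluster_iso p0 (order_iso_st _)) /em_weight.
  by rewrite (em_iso p0 (order_iso_st _)).
rewrite big_split /= (sum_words_split (fun=> 1)) // bin1 subn1 big_seq1 mul1r.
congr (_ + _); rewrite exchange_big /=; apply: eq_big_nat => l /andP[_ lt_ln].
by rewrite sum_words_split.
Qed.

(** In [em_sum_rec] the term with [l = n.+1] is [cluster_sum p n.+1] itself, so the recurrence can
    be solved for either sequence in terms of the other. *)
Lemma em_sum_cluster_sum p q : p != [::] -> q != [::] ->
  em_sum p =1 em_sum q <-> cluster_sum p =1 cluster_sum q.
Proof.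
move=> p0 q0; split=> eq_pq n; elim/ltn_ind: n => -[|n] IH.
- by rewrite !cluster_sum0.
- have := eq_pq n.+1; rewrite !em_sum_rec // eq_pq => /addrI.
  rewrite !(big_nat_recr n.+1) //= subnn binn !mul1r !em_sum0 // !mulr1.
  rewrite (eq_big_nat _ _ (F2 := fun l =>
    'C(n.+1, l)%:R * (cluster_sum q l * em_sum q (n.+1 - l)))).
    by move/addrI.
  by move=> l /andP[_ lt_ln]; rewrite IH // eq_pq.
- by rewrite !em_sum0.
(* The term [l = 0] vanishes, so only values of [em_sum] below [n.+1] matter. *)
rewrite !em_sum_rec // IH //; congr (_ + _); apply: eq_big_nat => -[|l] _.
  by rewrite !cluster_sum0 // !mul0r.
by rewrite eq_pq IH //; lia.
Qed.

Lemma em_sum_acount m (pi : 'S_m) n :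
  em_sum (pword pi) n = \sum_(k < n.+2) (1 + 'X) ^+ k *+ acount pi n k.
Proof.
rewrite /em_sum /em_weight.
transitivity (\sum_(w <- words n) 
    \sum_(k < n.+2 | em (pword pi) w == k) (1 + 'X : {poly int}) ^+ k).
  apply: eq_big_seq => w wn.
  have lt_em : (em (pword pi) w < n.+2)%N.
    rewrite ltnS /em size_filter (leq_trans (count_size _ _)) // size_iota.
    by rewrite (size_words wn) leq_subr.
  by rewrite (big_pred1 (Ordinal lt_em)) // => k; rewrite eq_sym.
rewrite (exchange_big_dep xpredT) //=; apply: eq_bigr => k _.
by rewrite acount_words -big_filter big_const_seq count_predT size_filter iter_addr_0.
Qed.

(** At ['X = -1] the base [1 + 'X] vanishes, so only the words without occurrences survive. *)
Lemma acount0_em_sum m (pi : 'S_m) n : (acount pi n 0)%:R = (em_sum (pword pi) n).[-1].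
Proof.
rewrite em_sum_acount horner_sum big_ord_recl /= big1 ?addr0 => [|k _].
  by rewrite expr0 hornerMn hornerC.
by rewrite hornerMn horner_exp hornerD hornerC hornerX subrr expr0n mul0rn.
Qed.

(** * Chains of occurrences sharing one letter *)

(** Consecutive occurrences start [(size p).-1] positions apart, hence share exactly one letter;
    [chain_count] below is then the number M_k. *)
Definition chain_occ p k w : bool :=
  all (fun j => occ p (drop (j * (size p).-1) w)) (iota 0 k).

Definition chain_count p k : nat := count (chain_occ p k) (words (k * (size p).-1).+1).

(** The range stops before the shift [(size p).-1], where two one-letter words are compared. *)
Definition overlap_free p : bool :=
  all (fun d => st (drop d p) != st (take (size p - d) p)) (iota 1 (size p).-2).

Lemma chain_occS p k w :
  chain_occ p k.+1 w = occ p w && chain_occ p k (drop (size p).-1 w).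
Proof.
rewrite /chain_occ /= mul0n drop0; congr (_ && _).
rewrite -[1%N]/(1 + 0)%N iotaDl all_map; apply: eq_all => j /=.
by rewrite drop_drop mulSn addnC.
Qed.

Lemma chain_occ2 p w : chain_occ p 2 w = occ p w && occ p (drop (size p).-1 w).
Proof. by rewrite !chain_occS andbT. Qed.

Lemma occ_iso_pattern p w : occ p w -> order_iso p (take (size p) w).
Proof. by move/eqP=> {1}<-; apply: order_iso_st. Qed.

Lemma overlap_free_occ p w d : overlap_free p -> occ p w -> (0 < d < (size p).-1)%N ->
  ~~ occ p (drop d w).
Proof.
move=> /allP nov occw d_p; apply/negP => occd.
have /eqP[] : st (drop d p) != st (take (size p - d) p).
  by apply: nov; rewrite mem_iota; lia.
apply/st_eqP; apply: order_iso_trans (order_iso_drop d (occ_iso_pattern occw)) _.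
apply/order_iso_sym/(order_iso_trans (order_iso_take _ (occ_iso_pattern occd))).
rewrite take_takel; last by lia.
by rewrite take_drop subnK //; lia.
Qed.

(** With [k] marks the length is at most [(k * (size p).-1).+1], and equality forces every distance
    to be [(size p).-1]. An overlap-free pattern admits no smaller distance, so the formula then
    holds for every length. *)
Lemma coef_cluster p k w : (1 < size p)%N ->
  (k * (size p).-1 < size w)%N || overlap_free p ->
  (cluster p w)`_k = [&& (0 < k)%N, size w == (k * (size p).-1).+1 & chain_occ p k w]%:R.
Proof.
move=> p_gt1; have p0 : p != [::] by case: p p_gt1.
elim: k w => [|k IH] w hyp; rewrite clusterE //.
  by case: (occ p w); rewrite ?mul1r ?mul0r ?coef0 // coefXM.
rewrite chain_occS; case: (boolP (occ p w)) => [occw|_]; last by rewrite !mul0r coef0 andbF.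
have le_pw := occ_size occw.
have defp : size p = (size p).-1.+1 by lia.
(* The distance [(size p).-1] is split off. A smaller one leaves a suffix too long for the remaining
   [k] marks, or gives no occurrence when [p] is overlap-free. *)
rewrite mul1r coefXM /= coefD coef_sum defp big_nat_recr /=; last by lia.
rewrite big1_seq => [|d]; last first.
  rewrite mem_index_iota => /andP[_ d_p].
  case/orP: hyp => [lt_kw|nov]; last first.
    by rewrite cluster_nocc ?coef0 // overlap_free_occ.
  rewrite IH size_drop; last by apply/orP; left; move: lt_kw; rewrite mulSn; lia.
  by rewrite [X in [&& _, X & _]](_ : _ = false) ?andbF //; move: lt_kw; rewrite mulSn; lia.
rewrite add0r IH size_drop; last by case/orP: hyp => [lt_kw|->]; rewrite ?orbT //;
   apply/orP; left; move: lt_kw; rewrite mulSn; lia.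
have -> : ((size w - (size p).-1)%N == (k * (size p).-1).+1) = (size w == (k.+1 * (size p).-1).+1).
  by rewrite mulSn; lia.
case: k {IH hyp} => [|k] /=.
  by rewrite mul1n addr0 andbT; case: (_ == _); rewrite ?coefC.
have -> : (((size w == (size p).-1.+1)%:R : {poly int})`_k.+1 = 0).
  by case: (_ == _); rewrite ?coef0 // coefC.
by rewrite add0r.
Qed.

Lemma coef_cluster_sum p k n : (1 < size p)%N ->
  (k * (size p).-1 < n)%N || overlap_free p ->
  (cluster_sum p n)`_k =
    (if (0 < k)%N && (n == (k * (size p).-1).+1) then chain_count p k else 0)%:R.
Proof.
move=> p_gt1 hyp; rewrite coef_sum.
transitivity (\sum_(w <- words n)
    [&& (0 < k)%N, n == (k * (size p).-1).+1 & chain_occ p k w]%:R : int).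
  by apply: eq_big_seq => w wn; rewrite coef_cluster // (size_words wn).
rewrite -natr_sum; congr (_%:R); case: (posnP k) => [->|k_gt0] /=; first by rewrite big1.
case: eqP => [->|_] /=; last by rewrite big1.
by rewrite /chain_count -sum1_count [RHS]big_mkcond; apply: eq_bigr => w _; case: chain_occ.
Qed.

Local Open Scope nat_scope.

Lemma occP n p w : p \in words n -> reflect (order_iso (take n w) p) (occ p w).
Proof.
move=> pn; rewrite /occ (size_words pn) -{2}(st_words pn).
exact: (iffP eqP) (st_eqP _ _).1 (st_eqP _ _).2.
Qed.

(* Moves the letters inside each block [j * m.-1, (j+1) * m.-1] of positions
   according to the permutation of positions that turns [p] into [q]. *)
Definition block_perm p q i : nat :=
  (i %/ (size p).-1) * (size p).-1 + index (nth 0 q (i %% (size p).-1)) p.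

(** The delicate value is [r = m.-1], which is also position 0 of the next block. The two readings
    agree because [p] and [q] have the same ends. *)
Lemma block_permE m p q j r : 1 < m -> p \in words m -> q \in words m ->
  nth 0 p 0 = nth 0 q 0 -> nth 0 p m.-1 = nth 0 q m.-1 -> r < m ->
  block_perm p q (j * m.-1 + r) = j * m.-1 + index (nth 0 q r) p.
Proof.
move=> m_gt1 pm qm e0 e1 lt_rm; rewrite /block_perm (size_words pm).
have m1 : 0 < m.-1 by lia.
case: (ltnP r m.-1) => [lt_r|le_r].
  by rewrite divnMDl // modnMDl divn_small // modn_small // addn0.
have -> : r = m.-1 by lia.
rewrite divnMDl // modnMDl divnn modnn m1 -e0 -e1.
by rewrite !index_uniq ?(uniq_words pm) ?(size_words pm) //; lia.
Qed.

Lemma index_nth_lt m p q r : p \in words m -> q \in words m -> r < m ->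
  index (nth 0 q r) p < m.
Proof.
move=> pm qm lt_rm; rewrite -[X in _ < X](size_words pm) index_mem (mem_words _ pm).
exact: nth_words.
Qed.

Lemma block_permK m p q i : 1 < m -> p \in words m -> q \in words m ->
  nth 0 p 0 = nth 0 q 0 -> nth 0 p m.-1 = nth 0 q m.-1 ->
  block_perm p q (block_perm q p i) = i.
Proof.
move=> m_gt1 pm qm e0 e1; have m1 : 0 < m.-1 by lia.
rewrite [X in block_perm p q X]/block_perm (size_words qm).
have lt_r : i %% m.-1 < m by have := ltn_pmod i m1; lia.
rewrite (block_permE _ m_gt1 pm qm e0 e1) ?index_nth_lt // nth_index.
  by rewrite index_uniq ?(uniq_words pm) ?(size_words pm) // -divn_eq.
by rewrite (mem_words _ qm) nth_words.
Qed.

Lemma block_perm_bound m p q k i : 1 < m -> p \in words m -> q \in words m ->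
  nth 0 p 0 = nth 0 q 0 -> nth 0 p m.-1 = nth 0 q m.-1 ->
  i <= k * m.-1 -> block_perm p q i <= k * m.-1.
Proof.
move=> m_gt1 pm qm e0 e1; have m1 : 0 < m.-1 by lia.
case: k => [|k] le_ik.
  have -> : i = 0 * m.-1 + 0 by lia.
  rewrite (block_permE _ m_gt1 pm qm e0 e1) //; last by lia.
  by rewrite -e0 index_uniq ?(uniq_words pm) ?(size_words pm) //; lia.
case: (ltnP (i %/ m.-1) k.+1) => [lt_d|le_d].
  have lt_r : i %% m.-1 < m by have := ltn_pmod i m1; lia.
  rewrite (divn_eq i m.-1) (block_permE _ m_gt1 pm qm e0 e1) //.
  have := index_nth_lt pm qm lt_r; have := leq_mul2r m.-1 (i %/ m.-1) k; rewrite mulSn; lia.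
have -> : i = k.+1 * m.-1 + 0.
  by have := divn_eq i m.-1; have := leq_mul2r m.-1 k.+1 (i %/ m.-1); lia.
rewrite (block_permE _ m_gt1 pm qm e0 e1) //; last by lia.
by rewrite -e0 index_uniq ?(uniq_words pm) ?(size_words pm) //; lia.
Qed.

(** In each block of a chain of [p], the letter of relative rank [nth 0 q r] is moved to place [r],
    which makes the block an occurrence of [q]. Shared letters stay in place, and the move of
    positions is invertible, so [Phi] is injective. *)
Lemma leq_chain_count m p q k : 1 < m -> p \in words m -> q \in words m ->
  nth 0 p 0 = nth 0 q 0 -> nth 0 p m.-1 = nth 0 q m.-1 ->
  chain_count p k <= chain_count q k.
Proof.
move=> m_gt1 pm qm e0 e1; rewrite /chain_count (size_words pm) (size_words qm).
set n := (k * _).+1.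
have bound i : i < n -> block_perm p q i < n by apply: (@block_perm_bound m).
have bound' i : i < n -> block_perm q p i < n by apply: (@block_perm_bound m).
pose Phi w := mkseq (fun i => nth 0 w (block_perm p q i)) n.
rewrite -!size_filter -(size_map Phi); apply: uniq_leq_size.
  rewrite map_inj_in_uniq ?filter_uniq ?permutations_uniq // => w w'.
  rewrite !mem_filter => /andP[_ wn] /andP[_ wn'] eqPhi.
  apply: (@eq_from_nth _ 0) => [|i]; rewrite (size_words wn) ?(size_words wn') // => lt_in.
  have := congr1 (fun z => nth 0 z (block_perm q p i)) eqPhi.
  by rewrite !nth_mkseq ?bound' // (@block_permK m).
move=> _ /mapP[w + ->]; rewrite !mem_filter => /andP[/allP chw wn].
apply/andP; split; last first.
  apply: mkseq_words => [i lt_in|i j lt_in lt_jn]; first by rewrite nth_words ?bound.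
  move/eqP; rewrite nth_uniq ?(uniq_words wn) ?(size_words wn) ?bound // => /eqP eq_ij.
  by rewrite -(@block_permK m q p i) // eq_ij (@block_permK m).
apply/allP => j jk; have /(occP _ pm)[_ iso] := chw _ jk.
rewrite (size_words qm); rewrite (size_words pm) in iso.
move: jk; rewrite mem_iota => /andP[_ lt_jk].
have le_jm : j * m.-1 + m <= n.
  by rewrite /n; have := leq_mul2r m.-1 j.+1 k; rewrite mulSn; lia.
have size_blk z : size z = n -> size (take m (drop (j * m.-1) z)) = m.
  by move=> sz; rewrite size_takel // size_drop sz; lia.
apply/(occP _ qm); split; first by rewrite size_blk ?size_mkseq ?(size_words qm).
rewrite size_blk ?size_mkseq // => a b lt_am lt_bm.
rewrite size_blk ?(size_words wn) // in iso.
have lt_a := index_nth_lt pm qm lt_am; have lt_b := index_nth_lt pm qm lt_bm.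
have := iso _ _ lt_a lt_b.
rewrite !nth_take // !nth_drop !nth_index ?(mem_words _ pm) ?nth_words // => <-.
rewrite !nth_mkseq; try lia.
by rewrite !(block_permE _ m_gt1 pm qm e0 e1).
Qed.

Lemma chain_count_ends m p q k : 1 < m -> p \in words m -> q \in words m ->
  nth 0 p 0 = nth 0 q 0 -> nth 0 p m.-1 = nth 0 q m.-1 ->
  chain_count p k = chain_count q k.
Proof.
move=> m_gt1 pm qm e0 e1; apply/eqP; rewrite eqn_leq.
by apply/andP; split; apply: leq_chain_count m_gt1 _ _ _ _.
Qed.

(** * Overlap-free words with prescribed ends *)

(* The word [a, a+1, .., m-1 (without b), 1, .., a-1, m, b]: it has a descent
   at its end, and the only other one is followed by the letter 1. *)
Definition free_letter m a b i : nat :=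
  if a + i < b then a + i else if a + i + 1 < m then a + i + 1
  else if i + 2 < m then a + i + 2 - m else if i + 2 == m then m else b.

Definition free_word m a b : seq nat := mkseq (free_letter m a b) m.

Lemma free_word_words m a b : 0 < a -> a < b -> b < m -> free_word m a b \in words m.
Proof.
move=> a_gt0 lt_ab lt_bm; apply: mkseq_words => [i|i j]; rewrite /free_letter.
  by do ![case: ifP => ?]; lia.
by do ![case: ifP => ?]; lia.
Qed.

Lemma free_word_first m a b : 0 < a -> a < b -> b < m -> nth 0 (free_word m a b) 0 = a.
Proof. by move=> *; rewrite nth_mkseq /free_letter; [case: ifP|]; lia. Qed.

Lemma free_word_last m a b : 0 < a -> a < b -> b < m -> nth 0 (free_word m a b) m.-1 = b.
Proof. by move=> *; rewrite nth_mkseq /free_letter; [do ![case: ifP => ?]|]; lia. Qed.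

Lemma free_letter_descent m a b i : 0 < a -> a < b -> b < m -> i.+2 < m ->
  free_letter m a b i.+1 < free_letter m a b i -> a + i + 2 = m /\ 1 < a.
Proof. by move=> ? ? ? ?; rewrite /free_letter; do ![case: ifP => ?]; lia. Qed.

(** An overlap at shift [d] matches the final descent from [m] to [b] with a descent of the prefix,
    which can only be the one ending at the letter 1. The letter before [m] is then [a.-1], below
    [b], so its match would have to lie below 1. *)
Lemma free_word_overlap_free m a b : 0 < a -> a < b -> b < m ->
  a = 1 \/ a + 2 < m -> overlap_free (free_word m a b).
Proof.
move=> a_gt0 lt_ab lt_bm a_m; apply/allP => d; rewrite mem_iota size_mkseq => d_m.
apply/eqP => /st_eqP[_]; rewrite size_drop size_mkseq => iso.
have [t eqm] : exists t, m = d + t.+2 by exists (m - d - 2); lia.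
have {}iso i j : i < t.+2 -> j < t.+2 ->
    (free_letter m a b (d + i) < free_letter m a b (d + j)) =
    (free_letter m a b i < free_letter m a b j).
  have -> : t.+2 = m - d by lia.
  move=> lt_i lt_j; have := iso i j lt_i lt_j.
  by rewrite !nth_drop !nth_take // !nth_mkseq //; clear -lt_i lt_j; lia.
have last_b : free_letter m a b (d + t.+1) = b.
  by clear iso; rewrite /free_letter; do ![case: ifP => ?]; lia.
have last_m : free_letter m a b (d + t) = m.
  by clear iso; rewrite /free_letter; do ![case: ifP => ?]; lia.
have [eq_t a_gt1] : a + t + 2 = m /\ 1 < a.
  apply: (@free_letter_descent m a b t) => //; first by lia.
  by rewrite -iso // last_b last_m.
(* Here [t = 0] would mean [a + 2 = m] with [1 < a]. *)
case: t => [|t] in eqm iso last_b last_m eq_t *; first by lia.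
have last_a : free_letter m a b (d + t) = a.-1.
  by clear iso last_b last_m; rewrite /free_letter; do ![case: ifP => ?]; lia.
have low : free_letter m a b t.+2 = 1.
  by clear iso last_b last_m last_a; rewrite /free_letter; do ![case: ifP => ?]; lia.
have := iso t t.+2; rewrite last_a last_b low.
have t_m : t < m by lia.
have /andP[] := nth_words (free_word_words a_gt0 lt_ab lt_bm) t_m.
by rewrite nth_mkseq //; lia.
Qed.

(** * Pairs of occurrences sharing one letter *)

(** Two increasing blocks sharing a letter form an increasing word. *)
Lemma chain_count_iota m : 1 < m -> chain_count (iota 1 m) 2 <= 1.
Proof.
move=> m_gt1; rewrite /chain_count -size_filter size_iota.
rewrite -[X in _ <= X]/(size [:: iota 1 (2 * m.-1).+1]).
apply: uniq_leq_size => [|w]; first by rewrite filter_uniq ?permutations_uniq.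
have pm : iota 1 m \in words m by rewrite mem_permutations.
rewrite mem_filter inE => /andP[]; rewrite chain_occ2 size_iota.
case/andP=> /(occP _ pm)[_ iso1] /(occP _ pm)[_ iso2] wn.
have sw := size_words wn; apply/eqP.
apply: (irr_sorted_eq ltn_trans ltnn); last 2 first.
- exact: (iota_ltn_sorted 1 (2 * m.-1).+1).
- by move: wn; rewrite mem_permutations => /perm_mem.
apply/(sortedP 0) => i; rewrite sw => lt_i.
case: (ltnP i.+1 m) => [lt_im|le_mi].
  have := iso1 i i.+1; rewrite size_takel ?sw; last by lia.
  by rewrite !nth_take ?nth_iota; lia.
have := iso2 (i - m.-1) (i - m.-1).+1.
rewrite size_takel ?size_drop ?sw; last by lia.
rewrite !nth_take ?nth_drop ?nth_iota; try lia.
by rewrite addnS subnKC; lia.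
Qed.

Definition glue m p (f g : nat -> nat) : seq nat :=
  mkseq (fun i => if i < m then f (nth 0 p i) else g (nth 0 p (i - m.-1))) (2 * m.-1).+1.

(** The maps [f] and [g] relabel the two blocks; they agree at the shared letter and meet nowhere
    else, so the glued letters are distinct. *)
Lemma glue_chain m p f g : 1 < m -> p \in words m ->
  {mono f : x y / x < y} -> {mono g : x y / x < y} ->
  f (nth 0 p m.-1) = g (nth 0 p 0) ->
  (forall x, 0 < x <= m -> 0 < f x <= (2 * m.-1).+1) ->
  (forall x, 0 < x <= m -> 0 < g x <= (2 * m.-1).+1) ->
  (forall x y, 0 < x <= m -> 0 < y <= m -> f x = g y -> y = nth 0 p 0) ->
  glue m p f g \in [seq w <- words (2 * m.-1).+1 | chain_occ p 2 w].
Proof.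
move=> m_gt1 pm fm gm fg fb gb dis.
have inj h x y : {mono h : x y / x < y} -> h x = h y -> x = y.
  by move=> hm eqh; have := hm x y; have := hm y x; rewrite eqh ltnn; lia.
have pinj i j : i < m -> j < m -> nth 0 p i = nth 0 p j -> i = j.
  by move=> ? ? /eqP; rewrite nth_uniq ?(uniq_words pm) ?(size_words pm) // => /eqP.
have pb i : i < m -> 0 < nth 0 p i <= m by exact: nth_words.
rewrite mem_filter; apply/andP; split; last first.
  apply: mkseq_words => [i lt_i|i j lt_i lt_j].
    by case: ifP => ?; [apply/fb/pb | apply/gb/pb; lia].
  case: ifP => ltm_i; case: ifP => ltm_j.
  - by move/(inj _ _ _ fm)/pinj; apply.
  - move/dis => dis0.
    have /pinj : nth 0 p (j - m.-1) = nth 0 p 0 by apply: dis0; apply: pb; lia.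
    by lia.
  - move/esym/dis => dis0.
    have /pinj : nth 0 p (i - m.-1) = nth 0 p 0 by apply: dis0; apply: pb; lia.
    by lia.
  by move/(inj _ _ _ gm)/pinj; lia.
have sg : size (glue m p f g) = (2 * m.-1).+1 by rewrite size_mkseq.
rewrite chain_occ2 (size_words pm); apply/andP; split; apply/(occP _ pm).
  split=> [|i j]; rewrite size_takel ?sg ?(size_words pm) //; try lia.
  move=> lt_i lt_j; rewrite !nth_take // !nth_mkseq; try lia.
  by rewrite lt_i lt_j fm.
split=> [|i j]; rewrite size_takel ?size_drop ?sg ?(size_words pm) //; try lia.
have second k : k < m -> nth 0 (glue m p f g) (m.-1 + k) = g (nth 0 p k).
  move=> lt_k; rewrite nth_mkseq; last by lia.
  case: ifP => lt_m; last by congr (g (nth 0 p _)); lia.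
  have -> : k = 0 by lia.
  by rewrite addn0.
by move=> lt_i lt_j; rewrite !nth_take // !nth_drop !second // gm.
Qed.

Lemma chain_count_gt1 m p : 1 < m -> p \in words m ->
  nth 0 p 0 < nth 0 p m.-1 -> (1 < nth 0 p 0) || (nth 0 p m.-1 < m) ->
  1 < chain_count p 2.
Proof.
move=> m_gt1 pm; set a := nth 0 p 0; set b := nth 0 p m.-1 => lt_ab not1m.
have a_m : 0 < a <= m by apply: nth_words pm _; lia.
have b_m : 0 < b <= m by apply: nth_words pm _; lia.
rewrite /chain_count -size_filter (size_words pm).
(* Below the shared letter lie [b - 1] letters of the first block and [a - 1] of the second, above
   it [m - b] and [m - a]. On both sides [f1] and [g1] put the letters of the first block lower,
   [f2] and [g2] those of the second. *)
pose f1 x := if x < b then x else x + a - 1.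
pose g1 x := if x <= a then x + b - 1 else x + m - 1.
pose f2 x := if x <= b then x + a - 1 else x + m - 1.
pose g2 x := if x < a then x else x + b - 1.
have in1 : glue m p f1 g1 \in [seq w <- words (2 * m.-1).+1 | chain_occ p 2 w].
  by apply: glue_chain => //; rewrite -/a -/b;
    [move=> x y|move=> x y| |move=> x|move=> x|move=> x y];
    rewrite /f1 /g1; do ![case: ifP => ?]; lia.
have in2 : glue m p f2 g2 \in [seq w <- words (2 * m.-1).+1 | chain_occ p 2 w].
  by apply: glue_chain => //; rewrite -/a -/b;
    [move=> x y|move=> x y| |move=> x|move=> x|move=> x y];
    rewrite /f2 /g2; do ![case: ifP => ?]; lia.
suff neq : glue m p f1 g1 != glue m p f2 g2.
  rewrite -[X in X < _]/(size [:: glue m p f1 g1]).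
  apply: (@uniq_leq_size _ [:: glue m p f1 g1; glue m p f2 g2]).
    by rewrite /= inE neq.
  by move=> w; rewrite !inE => /orP[] /eqP ->.
(* The first letters are [a] and [2 * a - 1], the last ones [b + m - 1] and [2 * b - 1]; both pairs
   agree only for [a = 1] and [b = m]. *)
apply/eqP => eqg; have := congr1 (fun w => nth 0 w 0) eqg.
have := congr1 (fun w => nth 0 w (2 * m.-1)) eqg.
rewrite !nth_mkseq // ltnNge (_ : m <= 2 * m.-1) /=; last by lia.
rewrite (_ : 2 * m.-1 - m.-1 = m.-1) ?(ltnW m_gt1) -/a -/b; last by lia.
rewrite /f1 /f2 /g1 /g2 lt_ab (ltnW lt_ab) (leqNgt b a) lt_ab (ltnNge b a) (ltnW lt_ab) /=.
clear -a_m b_m not1m lt_ab; lia.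
Qed.

(** For [m = 4] the ends in standard form with last letter below 4 are (1, 2), (1, 3) and (2, 3).
    This count and the next two tell them apart. *)
Lemma chain_count_1342 : chain_count [:: 1; 3; 4; 2] 2 = 10.
Proof. by vm_compute. Qed.

Lemma chain_count_1243 : chain_count [:: 1; 2; 4; 3] 2 = 4.
Proof. by vm_compute. Qed.

Lemma chain_count_2143 : chain_count [:: 2; 1; 4; 3] 2 = 9.
Proof. by vm_compute. Qed.

(** * Strong equivalence and the end letters *)

(** Strong equivalence gives equal cluster polynomials, and at length [(k * m.-1).+1] the
    coefficient of ['X^k] counts the chains. *)
Lemma strong_chain_count m (pi tau : 'S_m) k : 1 < m -> 0 < k ->
  strong_cwilf_equiv pi tau -> chain_count (pword pi) k = chain_count (pword tau) k.
Proof.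
move=> m_gt1 k_gt0 strong.
have pm := pword_words pi; have tm := pword_words tau.
have sp := size_words pm; have st := size_words tm.
have p0 : pword pi != [::] by rewrite -size_eq0 sp; lia.
have t0 : pword tau != [::] by rewrite -size_eq0 st; lia.
have /(em_sum_cluster_sum p0 t0) eq_cl : em_sum (pword pi) =1 em_sum (pword tau).
  by move=> n; rewrite !em_sum_acount; apply: eq_bigr => j _; rewrite strong.
have := congr1 (fun P : {poly int} => P`_k)%R (eq_cl (k * m.-1).+1).
rewrite !coef_cluster_sum ?sp ?st ?leqnn // k_gt0 eqxx /=.
by move/eqP; rewrite Num.Theory.eqr_nat => /eqP.
Qed.

(** For overlap-free patterns chains are the only clusters, so their numbers fix all cluster sums
    and hence the numbers of avoiders. *)
Lemma chain_count_cwilf m (pi tau : 'S_m) : 1 < m ->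
  overlap_free (pword pi) -> overlap_free (pword tau) ->
  (forall k, 0 < k -> chain_count (pword pi) k = chain_count (pword tau) k) ->
  cwilf_equiv pi tau.
Proof.
move=> m_gt1 fp ft eqc n.
have sp := size_words (pword_words pi); have st := size_words (pword_words tau).
have p0 : pword pi != [::] by rewrite -size_eq0 sp; lia.
have t0 : pword tau != [::] by rewrite -size_eq0 st; lia.
have /(em_sum_cluster_sum p0 t0) eq_em : cluster_sum (pword pi) =1 cluster_sum (pword tau).
  move=> l; apply/polyP => k.
  rewrite !coef_cluster_sum ?fp ?ft ?orbT ?sp ?st //.
  by case: (posnP k) => //= k_gt0; rewrite eqc.
have := acount0_em_sum pi n; rewrite eq_em -acount0_em_sum.
by move/eqP; rewrite Num.Theory.eqr_nat => /eqP.
Qed.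

Lemma overlap_free_non_overlapping m (pi : 'S_m) : 1 < m ->
  overlap_free (pword pi) -> non_overlapping pi.
Proof.
move=> m_gt1 /allP free; rewrite /non_overlapping /overlap_set.
have sp := size_words (pword_words pi).
(* The shift [m.-1] is separated: it compares one-letter words, so it is always an overlap. *)
have {1}-> : m.-1 = m.-2 + 1 by lia.
rewrite iotaD filter_cat (_ : [seq i <- iota 1 m.-2 | _] = [::]); last first.
  apply/eqP; rewrite -(negbK (_ == _)) -has_filter; apply/negP => /hasP[i im].
  by apply/negP; have := free i; rewrite sp; apply.
have -> : 1 + m.-2 = m.-1 by lia.
rewrite /= (_ : m - m.-1 = 1); last by lia.
case: ifP => // /negP[]; apply/eqP/st_eqP; split=> [|i j].
  by rewrite size_drop size_takel sp; lia.
rewrite size_drop sp => lt_i lt_j.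
have -> : i = 0 by lia.
have -> : j = 0 by lia.
by rewrite !ltnn.
Qed.

Lemma exists_overlap_free m (pi : 'S_m) :
  standard_form pi -> plast pi < m -> ~ (m = 4 /\ pfirst pi = 2) ->
  exists rho : 'S_m, [/\ overlap_free (pword rho), pfirst rho = pfirst pi,
    plast rho = plast pi & forall k, chain_count (pword rho) k = chain_count (pword pi) k].
Proof.
move=> [lt_ab le_ab] lt_bm nexc; set a := pfirst pi in lt_ab le_ab nexc *.
set b := plast pi in lt_ab le_ab lt_bm *.
have m_gt1 : 1 < m by lia.
have pm := pword_words pi.
have a_gt0 : 0 < a by have /andP[] := nth_words pm (ltnW m_gt1).
have fm := free_word_words a_gt0 lt_ab lt_bm.
have f0 := free_word_first a_gt0 lt_ab lt_bm; have f1 := free_word_last a_gt0 lt_ab lt_bm.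
have [rho def_rho] := wordsP fm; exists rho; rewrite /pfirst /plast def_rho.
(* Standard form gives [2 * a <= m], so [a = 1] or [a + 2 < m] can fail only for [a = 2] and
   [m = 4]. *)
split=> // [|k]; first by apply: free_word_overlap_free => //; lia.
exact: (@chain_count_ends m).
Qed.

(** Together with [chain_count_small] this recognizes the ends (1, m), to which the free words do
    not apply. The identity represents these ends. *)
Lemma chain_count_full m (pi : 'S_m) : 1 < m -> pfirst pi = 1 -> plast pi = m ->
  chain_count (pword pi) 2 <= 1.
Proof.
move=> m_gt1 e0 e1; rewrite (@chain_count_ends m _ (iota 1 m)) ?chain_count_iota //.
- exact: pword_words.
- by rewrite mem_permutations.
- by rewrite nth_iota //; lia.
- by rewrite nth_iota; [rewrite -/(plast pi) e1|]; lia.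
Qed.

Lemma chain_count_small m (pi : 'S_m) : 1 < m -> standard_form pi ->
  chain_count (pword pi) 2 <= 1 -> pfirst pi = 1 /\ plast pi = m.
Proof.
move=> m_gt1 [lt_ab le_ab] small; have pm := pword_words pi.
have /andP[a_gt0 _] : 0 < pfirst pi <= m by apply: nth_words pm _; lia.
have /andP[_ le_bm] : 0 < plast pi <= m by apply: nth_words pm _; lia.
case: (boolP ((1 < pfirst pi) || (plast pi < m))) => [big|]; last by lia.
by have := chain_count_gt1 m_gt1 pm lt_ab big; lia.
Qed.

Lemma chain_count_order4 (pi tau : 'S_4) :
  standard_form pi -> standard_form tau -> plast tau < 4 -> pfirst pi = 2 ->
  chain_count (pword pi) 2 = chain_count (pword tau) 2 -> pfirst tau = 2 /\ plast tau = plast pi.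
Proof.
move=> [lt_ab le_ab] [lt_ab' le_ab'] lt_b' a2.
have pm := pword_words pi; have tm := pword_words tau.
have /andP[a_gt0 _] : 0 < pfirst tau <= 4 by apply: nth_words tm _.
have b3 : plast pi = 3 by lia.
rewrite (@chain_count_ends 4 _ [:: 2; 1; 4; 3] 2 isT pm isT a2 b3) chain_count_2143.
case: (ltnP 1 (pfirst tau)) => [|le_a1 eq9]; first by lia.
have a1 : pfirst tau = 1 by lia.
case: (ltnP 2 (plast tau)) => [lt_2b|le_b2].
  have b3' : plast tau = 3 by lia.
  by rewrite (@chain_count_ends 4 _ [:: 1; 2; 4; 3] 2 isT tm isT a1 b3') chain_count_1243 in eq9.
have b2 : plast tau = 2 by lia.
by rewrite (@chain_count_ends 4 _ [:: 1; 3; 4; 2] 2 isT tm isT a1 b2) chain_count_1342 in eq9.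
Qed.

Theorem theorem1p8 :
  (forall (m : nat) (pi tau : 'S_m), 1 <= m ->
      non_overlapping pi -> non_overlapping tau ->
      standard_form pi -> standard_form tau ->
      cwilf_equiv pi tau ->
      pfirst pi = pfirst tau /\ plast pi = plast tau) ->
  (forall (m : nat) (pi tau : 'S_m), 1 <= m ->
      standard_form pi -> standard_form tau ->
      strong_cwilf_equiv pi tau ->
      pfirst pi = pfirst tau /\ plast pi = plast tau).
Proof.
move=> A m pi tau m_gt0 sf_pi sf_tau strong.
have le_last (s : 'S_m) : plast s <= m.
  by have /andP[] : 0 < plast s <= m by apply: nth_words (pword_words s) _; lia.
have gt0_first (s : 'S_m) : 0 < pfirst s.
  by have /andP[] : 0 < pfirst s <= m by apply: nth_words (pword_words s) _.
have m_gt1 : 1 < m by case: (sf_pi); have := gt0_first pi; have := le_last pi; lia.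
have eqc k : 0 < k -> chain_count (pword pi) k = chain_count (pword tau) k.
  by move=> k_gt0; apply: strong_chain_count.
have full (s t : 'S_m) : standard_form s -> standard_form t ->
    chain_count (pword s) 2 = chain_count (pword t) 2 -> plast s = m ->
    pfirst s = pfirst t /\ plast s = plast t.
  move=> [lt_s le_s] sf_t eq_st last_s.
  have first_s : pfirst s = 1 by have := gt0_first s; lia.
  have := chain_count_full m_gt1 first_s last_s; rewrite eq_st.
  by case/(chain_count_small m_gt1 sf_t) => -> ->.
case: (ltnP (plast pi) m) => [last_pi|ge_pi]; last first.
  by apply: full => //; [exact: eqc | have := le_last pi; lia].
case: (ltnP (plast tau) m) => [last_tau|ge_tau]; last first.
  by have [|-> ->] := full tau pi sf_tau sf_pi (esym (eqc 2 isT));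
    first by have := le_last tau; lia.
have order4 (s t : 'S_m) : standard_form s -> standard_form t -> plast t < m ->
    chain_count (pword s) 2 = chain_count (pword t) 2 -> m = 4 /\ pfirst s = 2 ->
    pfirst s = pfirst t /\ plast s = plast t.
  move=> + + + + [m4]; move: s t; rewrite m4 => s t sf_s sf_t lt_t eq_st first_s.
  by have [] := chain_count_order4 sf_s sf_t lt_t first_s eq_st; rewrite first_s.
case: (boolP ((m == 4) && (pfirst pi == 2))) => [/andP[/eqP ? /eqP ?]|exc_pi].
  by apply: order4 => //; exact: eqc.
case: (boolP ((m == 4) && (pfirst tau == 2))) => [/andP[/eqP ? /eqP ?]|exc_tau].
  by have [|-> ->] := order4 tau pi sf_tau sf_pi last_pi (esym (eqc 2 isT)).
(* In the remaining case both patterns have overlap-free companions with the same ends and chain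
   counts, and (A) is applied to these. *)
have [|rho [free_rho first_rho last_rho eq_rho]] := exists_overlap_free sf_pi last_pi; first by lia.
have [|ups [free_ups first_ups last_ups eq_ups]] := exists_overlap_free sf_tau last_tau; first by lia.
rewrite -first_rho -first_ups -last_rho -last_ups; apply: A => //.
- exact: overlap_free_non_overlapping.
- exact: overlap_free_non_overlapping.
- by rewrite /standard_form first_rho last_rho.
- by rewrite /standard_form first_ups last_ups.
by apply: chain_count_cwilf => // k k_gt0; rewrite eq_rho eq_ups eqc.
Qed.
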